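(* Let $n,p$ be integers with $1\le p\le n-1$. Then $$C_{n,p}^2\le\binom{n-2}{p-1}.$$
   Context: Let $\Lambda^p(\mathbf{R}^n)$ be the space of $p$-vectors in $\mathbf{R}^n$ with its standard Euclidean norm $|\cdot|$ (for an orthonormal basis $e_1,\dots,e_n$ of $\mathbf{R}^n$, the $p$-vectors $e_{i_1}\wedge\cdots\wedge e_{i_p}$, $i_1<\cdots<i_p$, are orthonormal), and let $\Lambda^p(\mathbf{R}^n)^*$ be its dual space, the space of $p$-covectors, with the dual Euclidean norm $|\cdot|^*$ (the $e_{i_1}^*\wedge\cdots\wedge e_{i_p}^*$ are orthonormal and form the basis dual to the $e_{i_1}\wedge\cdots\wedge e_{i_p}$). A $p$-vector is simple if it is a wedge product of $p$ vectors. The comass of $\phi\in\Lambda^p(\mathbf{R}^n)^*$ is $$\Vert\phi\Vert^*=\sup\{\phi(\xi):\xi\in\Lambda^p(\mathbf{R}^n)\text{ simple},\ |\xi|\le 1\}.$$ Define $$C_{n,p}=\sup\left\{\frac{|\phi|^*}{\Vert\phi\Vert^*}:\phi\in\Lambda^p(\mathbf{R}^n)^*,\ \phi\ne0\right\}.$$ *)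

(* Defs.v *)
From HB Require Import structures.
From mathcomp Require Import all_boot all_order all_algebra.
From mathcomp Require Import all_classical all_reals all_analysis.

Set Implicit Arguments.
Unset Strict Implicit.
Unset Printing Implicit Defensive.

Import Order.TTheory GRing.Theory Num.Theory.

Local Open Scope classical_set_scope.
Local Open Scope ring_scope.

Definition increasing (n p : nat) (f : {ffun 'I_p -> 'I_n}) : bool :=
  [forall i : 'I_p, forall j : 'I_p, (i < j)%N ==> (f i < f j)%N].

(* Sequences i_1 < ... < i_p in {0, ..., n-1}; they index the standard basis
   of the p-vectors of R^n. *)
Notation multiindex n p :=
  {f : {ffun 'I_p -> 'I_n} | increasing f}.

(* A p-vector is given by its coordinates in the basis
   e_{i_1} /\ ... /\ e_{i_p}, i_1 < ... < i_p. *)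
Definition pvector (R : realType) (n p : nat) : vectType R :=
  {ffun multiindex n p -> R^o}.

Definition pbasis (R : realType) (n p : nat) (I : multiindex n p) :
  pvector R n p := [ffun J => (J == I)%:R].

Definition pnorm (R : realType) (n p : nat) (xi : pvector R n p) : R :=
  Num.sqrt (\sum_(I : multiindex n p) (xi I : R) ^+ 2).

(* v_1 /\ ... /\ v_p = \sum_I det (v_i)_{I_j} e_I; the lemmas wedge_linear,
   wedge_alternating and wedge_basis below characterize this map. *)
Definition wedge (R : realType) (n p : nat) (v : 'I_p -> 'rV[R]_n) :
  pvector R n p :=
  [ffun I : multiindex n p => \det (\matrix_(i, j) v i 0 (val I j))].

Definition simple (R : realType) (n p : nat) (xi : pvector R n p) : Prop :=
  exists v : 'I_p -> 'rV[R]_n, xi = wedge v.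

Definition pcovector (R : realType) (n p : nat) : vectType R :=
  'Hom(pvector R n p, R^o).

(* The numbers phi e_I are the coordinates of phi in the dual basis. *)
Definition dual_norm (R : realType) (n p : nat) (phi : pcovector R n p) : R :=
  Num.sqrt (\sum_(I : multiindex n p) (phi (pbasis R I) : R) ^+ 2).

(* By comass_has_sup the supremum is over a nonempty bounded set. *)
Definition comass (R : realType) (n p : nat) (phi : pcovector R n p) : R :=
  sup [set (phi xi : R) | xi in [set xi : pvector R n p |
                                  simple xi /\ pnorm xi <= 1]].

(* An extended real, so that the supremum needs no prior bound.  The
   denominators are positive by comass_gt0 (for p > 0). *)
Definition comass_constant (R : realType) (n p : nat) : \bar R :=
  ereal_sup [set (dual_norm phi / comass phi)%:E
            | phi in [set phi : pcovector R n p | phi != 0]].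

Lemma wedge_linear (R : realType) (n p : nat) (v : 'I_p -> 'rV[R]_n)
    (i : 'I_p) (a : R) (x y : 'rV[R]_n) :
  wedge (fun k => if k == i then a *: x + y else v k) =
  a *: wedge (fun k => if k == i then x else v k) +
  wedge (fun k => if k == i then y else v k).
Proof.
apply/ffunP => I; rewrite !ffunE.
transitivity (a * \det (\matrix_(k, j) (if k == i then x else v k) 0 (val I j))
   + 1 * \det (\matrix_(k, j) (if k == i then y else v k) 0 (val I j)));
  last by rewrite mul1r.
apply: (determinant_multilinear (i0 := i)).
- by apply/rowP => j; rewrite !mxE eqxx !mxE mul1r.
- by apply/matrixP => k j; rewrite !mxE eq_sym (negbTE (neq_lift _ _)).
- by apply/matrixP => k j; rewrite !mxE eq_sym (negbTE (neq_lift _ _)).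
Qed.

Lemma wedge_alternating (R : realType) (n p : nat) (v : 'I_p -> 'rV[R]_n)
    (i j : 'I_p) :
  i != j -> v i = v j -> wedge v = 0.
Proof.
move=> ij vij; apply/ffunP => I; rewrite !ffunE.
by apply: (determinant_alternate ij) => k; rewrite !mxE vij.
Qed.

Lemma multiindex_lt (n p : nat) (I : multiindex n p) (i j : 'I_p) :
  (i < j)%N -> (val I i < val I j)%N.
Proof. by have /forallP/(_ i)/forallP/(_ j)/implyP := valP I. Qed.

Lemma multiindex_inj (n p : nat) (I : multiindex n p) : injective (val I).
Proof.
move=> i j eqI; apply/val_inj => /=.
by case: (ltngtP i j) => // /(@multiindex_lt _ _ I); rewrite eqI ltnn.
Qed.

Lemma multiindex_codom (n p : nat) (I J : multiindex n p) :
  (forall i, val I i \in codom (val J)) -> I = J.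
Proof.
have srt (K : multiindex n p) :
    sorted (fun a b : 'I_n => (a < b)%N) [seq val K i | i <- enum 'I_p].
  rewrite sorted_map.
  have : sorted ltn (map val (enum 'I_p)) by rewrite val_enum_ord iota_ltn_sorted.
  rewrite sorted_map; apply: sub_sorted => i j; exact: multiindex_lt.
move=> IJ; apply/val_inj/ffunP => i.
have /eq_in_map/(_ i) : [seq val I i | i <- enum 'I_p] = [seq val J i | i <- enum 'I_p].
  apply: (@irr_sorted_eq _ (fun a b : 'I_n => (a < b)%N)).
  - by move=> ? ? ?; apply: ltn_trans.
  - by move=> ?; apply: ltnn.
  - exact: srt.
  - exact: srt.
  have uI : uniq [seq val I i | i <- enum 'I_p].
    by rewrite map_inj_uniq ?enum_uniq //; apply: multiindex_inj.
  apply: (uniq_min_size uI _ _).2.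
  - by move=> x /mapP[k _ ->]; apply: IJ.
  - by rewrite !size_map.
by apply; rewrite mem_enum.
Qed.

Lemma wedge_basis (R : realType) (n p : nat) (I : multiindex n p) :
  wedge (fun i => delta_mx 0 (val I i)) = pbasis R I.
Proof.
apply/ffunP => J; rewrite !ffunE; have [<-|JI] := eqVneq.
  rewrite (_ : \matrix_(_, _) _ = 1%:M) ?det1 //; apply/matrixP => i j.
  by rewrite !mxE eqxx /= eq_sym (inj_eq (@multiindex_inj _ _ J)).
have [i iJ] : exists i, val I i \notin codom (val J).
  apply/existsP; apply: contra_neqT JI; rewrite negb_exists => /forallP IJ.
  by apply/esym/multiindex_codom => i; move: (IJ i); rewrite negbK.
rewrite (expand_det_row _ i) big1 // => j _; rewrite !mxE eqxx /=.
case: eqP => [Jj|]; last by rewrite mul0r.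
by rewrite -Jj codom_f in iJ.
Qed.

Lemma pvector_sum (R : realType) (n p : nat) (xi : pvector R n p) :
  xi = \sum_(I : multiindex n p) xi I *: pbasis R I.
Proof.
apply/ffunP => J; rewrite sum_ffunE (bigD1 J) //= !ffunE eqxx.
rewrite big1 ?addr0 => [|I IJ]; first by rewrite /GRing.scale /= mulr1.
by rewrite !ffunE eq_sym (negbTE IJ) scaler0.
Qed.

Lemma normr_pnorm (R : realType) (n p : nat) (xi : pvector R n p)
    (I : multiindex n p) : `|xi I : R| <= pnorm xi.
Proof.
rewrite -sqrtr_sqr ler_wsqrtr // (bigD1 I) //= lerDl.
by apply: sumr_ge0 => J _; rewrite sqr_ge0.
Qed.

Lemma pnormZ_pbasis (R : realType) (n p : nat) (a : R) (I : multiindex n p) :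
  pnorm (a *: pbasis R I) = `|a|.
Proof.
rewrite /pnorm (bigD1 I) //= big1 ?addr0 => [|J JI].
  by rewrite !ffunE eqxx /GRing.scale /= mulr1 sqrtr_sqr.
by rewrite !ffunE (negbTE JI) scaler0 expr0n.
Qed.

Lemma simpleZ_pbasis (R : realType) (n p : nat) (a : R) (I : multiindex n p) :
  (0 < p)%N -> simple (a *: pbasis R I).
Proof.
case: p I => // p I _.
exists (fun k => if k == ord0 then a *: delta_mx 0 (val I ord0) + 0
                 else delta_mx 0 (val I k)).
rewrite wedge_linear -wedge_basis.
have -> : wedge (fun k => if k == ord0 then 0 : 'rV[R]_n
                 else delta_mx 0 (val I k)) = 0.
  apply/ffunP => J; rewrite !ffunE (expand_det_row _ ord0) big1 // => j _.
  by rewrite !mxE mul0r.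
rewrite addr0; congr (_ *: wedge _).
by apply/funext => k; case: eqP => // ->.
Qed.

Lemma comass_has_sup (R : realType) (n p : nat) (phi : pcovector R n p) :
  has_sup [set (phi xi : R) | xi in [set xi : pvector R n p |
                                     simple xi /\ pnorm xi <= 1]].
Proof.
split.
  exists (phi (wedge (fun=> 0))), (wedge (fun=> 0)) => //; split; first by eexists.
  rewrite /pnorm; case: p phi => [|p] phi.
    have [I|e] := pickP (fun _ : multiindex n 0 => true).
      move=> _; rewrite (bigD1 I) //= big1 => [|J].
        by rewrite ffunE det_mx00 expr1n addr0 sqrtr1.
      by rewrite (_ : J = I) ?eqxx //; apply/val_inj/ffunP => -[].
    by rewrite big_pred0 // sqrtr0.
  rewrite big1 ?sqrtr0 // => I _.
  by rewrite ffunE (expand_det_row _ ord0) big1 ?expr0n // => j _; rewrite !mxE mul0r.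
exists (\sum_(I : multiindex n p) `|phi (pbasis R I) : R|) => _ [xi [_ xi1] <-].
rewrite [xi in phi xi]pvector_sum linear_sum (le_trans (ler_norm _)) //.
rewrite (le_trans (ler_norm_sum _ _ _)) // ler_sum // => I _.
rewrite linearZ /= normrM ler_piMl //.
exact: le_trans (normr_pnorm xi I) xi1.
Qed.

Lemma comass_gt0 (R : realType) (n p : nat) (phi : pcovector R n p) :
  (0 < p)%N -> phi != 0 -> 0 < comass phi.
Proof.
move=> p0 phi0.
have [I phiI] : exists I, phi (pbasis R I) != 0.
  apply/existsP; apply: contra_neqT phi0; rewrite negb_exists => /forallP e.
  apply/lfunP => xi; rewrite lfunE /= [xi]pvector_sum linear_sum big1 // => I _.
  by move: (e I); rewrite negbK linearZ /= => /eqP ->; rewrite scaler0.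
have : 0 < `|phi (pbasis R I) : R| by rewrite normr_gt0.
move=> /lt_le_trans; apply.
rewrite normrEsg; apply: sup_ubound; first by case: (comass_has_sup phi).
exists (Num.sg (phi (pbasis R I) : R) *: pbasis R I); last by rewrite linearZ.
split; first exact: simpleZ_pbasis.
by rewrite pnormZ_pbasis normr_sg; case: (_ != _).
Qed.

(* Main.v *)
Require Import Defs.
From HB Require Import structures.
From mathcomp Require Import all_boot all_order all_algebra.
From mathcomp Require Import all_classical all_reals all_analysis.

Set Implicit Arguments.
Unset Strict Implicit.
Unset Printing Implicit Defensive.

Import Order.TTheory GRing.Theory Num.Theory.

Local Open Scope ring_scope.

(** Split off one coordinate e_0 of R^(n+1).  A (p+1)-covector on R^(n+1) is
    phi = phi_0 + e_0^* /\ psi, where phi_0 is a (p+1)-covector and psi a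
    p-covector of R^n, and the basis covectors of the two parts are disjoint:
      |phi|^2 = |phi_0|^2 + |psi|^2                     (dual_norm_split).
    Both parts have comass at most that of phi.  Indeed phi_0 (xi) = phi (xi)
    and psi (xi) = phi (e_0 /\ xi), and if xi is a simple multivector of R^n,
    then xi and e_0 /\ xi are simple multivectors of R^(n+1) of the same norm
    (comass_pull_shift, comass_pull_cons).  Therefore
      C_(n+1,p+1)^2 <= C_(n,p+1)^2 + C_(n,p)^2,
    which is Pascal's rule for the binomials 'C(n - 2, p - 1).

    The recursion stops at p = 1 and at p = n - 1, where the binomial is 1.
    There every p-vector is simple (simple_1vector, simple_nvector_codim1), so
    phi can be evaluated at the p-vector with the same coordinates as phi,
    scaled to norm 1, and |phi| <= comass phi (dual_norm_le_comass).  One must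
    stop at p = n - 1 and not at p = n: the binomial 'C(n - 2, n - 1) is 0
    while C_(n,n) = 1. *)

(** * Multiindices with and without the first index *)

Lemma increasingP (n p : nat) (f : {ffun 'I_p -> 'I_n}) :
  reflect (forall i j : 'I_p, (i < j)%N -> (f i < f j)%N) (increasing f).
Proof.
apply: (iffP forallP) => [H i j|H i].
  by have /forallP/(_ j)/implyP := H i.
by apply/forallP => j; apply/implyP; apply: H.
Qed.

Lemma shift_increasing (n p : nat) (I : multiindex n p) :
  increasing [ffun i => lift ord0 (val I i)].
Proof.
by apply/increasingP => i j ij; rewrite !ffunE !lift0 ltnS multiindex_lt.
Qed.

Definition shift_index (n p : nat) (I : multiindex n p) : multiindex n.+1 p :=
  exist _ [ffun i => lift ord0 (val I i)] (shift_increasing I).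

Lemma cons_increasing (n p : nat) (I : multiindex n p) :
  increasing [ffun i : 'I_p.+1 =>
    oapp (fun k => lift ord0 (val I k)) ord0 (unlift ord0 i)].
Proof.
apply/increasingP => i j; rewrite !ffunE.
case: (unliftP ord0 j) => [j'|] -> //=.
case: (unliftP ord0 i) => [i'|] -> //=.
by rewrite /bump !leq0n !add1n !ltnS; apply: multiindex_lt.
Qed.

Definition cons_index (n p : nat) (I : multiindex n p) :
    multiindex n.+1 p.+1 :=
  exist _ [ffun i : 'I_p.+1 =>
    oapp (fun k => lift ord0 (val I k)) ord0 (unlift ord0 i)]
    (cons_increasing I).

Lemma shift_indexE (n p : nat) (I : multiindex n p) i :
  val (shift_index I) i = lift ord0 (val I i).
Proof. by rewrite ffunE. Qed.

Lemma cons_index0 (n p : nat) (I : multiindex n p) :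
  val (cons_index I) ord0 = ord0.
Proof. by rewrite ffunE unlift_none. Qed.

Lemma cons_indexS (n p : nat) (I : multiindex n p) i :
  val (cons_index I) (lift ord0 i) = lift ord0 (val I i).
Proof. by rewrite ffunE liftK. Qed.

Lemma shift_index_inj (n p : nat) : injective (@shift_index n p).
Proof.
move=> I J eIJ; apply/val_inj/ffunP => i.
by apply: (@lift_inj _ ord0); rewrite -!shift_indexE eIJ.
Qed.

Lemma cons_index_inj (n p : nat) : injective (@cons_index n p).
Proof.
move=> I J eIJ; apply/val_inj/ffunP => i.
by apply: (@lift_inj _ ord0); rewrite -!cons_indexS eIJ.
Qed.

Lemma cons_neq_shift (n p : nat) (I : multiindex n p) (J : multiindex n p.+1) :
  cons_index I <> shift_index J.
Proof.
move=> eIJ; have := congr1 (fun K : multiindex n.+1 p.+1 => val K ord0) eIJ.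
by rewrite cons_index0 shift_indexE => /eqP; rewrite (negbTE (neq_lift _ _)).
Qed.

(** Stated for functions because it is used both for a multiindex that avoids
    0 and for the tail of a multiindex that starts with 0. *)
Lemma unshift_exists (n p : nat) (f : 'I_p -> 'I_n.+1) :
  (forall i, 0 < f i)%N -> {homo f : i j / (i < j)%N} ->
  exists I : multiindex n p, forall i, f i = lift ord0 (val I i).
Proof.
move=> f0 fmon.
have lt i : ((f i).-1 < n)%N by rewrite -ltnS prednK.
have inc : increasing [ffun i => Ordinal (lt i)].
  apply/increasingP => i j ij; rewrite !ffunE /=.
  by rewrite -ltnS !prednK // fmon.
exists (exist _ [ffun i => Ordinal (lt i)] inc) => i; apply/val_inj.
by rewrite /= ffunE /bump leq0n add1n prednK.
Qed.

Lemma multiindex_cases (n p : nat) (J : multiindex n.+1 p.+1) :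
  (exists I, J = shift_index I) \/ (exists I, J = cons_index I).
Proof.
have [J0|J0] := posnP (val J ord0); [right|left].
- have [i|i j ij|I IE] :=
    @unshift_exists n p (fun i => val J (lift ord0 i)).
  + by rewrite -J0 multiindex_lt.
  + by rewrite multiindex_lt // !lift0.
  exists I; apply/val_inj/ffunP => i.
  have [i'|] := unliftP ord0 i => ->; first by rewrite cons_indexS IE.
  by rewrite cons_index0; apply/val_inj.
- have [i|i j|I IE] := @unshift_exists n p.+1 (val J).
  + have [i'|] := unliftP ord0 i => -> //.
    by rewrite (leq_trans J0) // ltnW // multiindex_lt.
  + exact: multiindex_lt.
  by exists I; apply/val_inj/ffunP => i; rewrite shift_indexE IE.
Qed.

Lemma sum_multiindexS (V : nmodType) (n p : nat)
    (F : multiindex n.+1 p.+1 -> V) :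
  \sum_J F J = \sum_I F (shift_index I) + \sum_I F (cons_index I).
Proof.
rewrite (perm_big (map (@shift_index n p.+1) (index_enum _)
  ++ map (@cons_index n p) (index_enum _))).
  by rewrite big_cat !big_map.
apply: uniq_perm; first exact: index_enum_uniq.
  rewrite cat_uniq !map_inj_uniq ?index_enum_uniq;
    try solve [exact: shift_index_inj | exact: cons_index_inj].
  rewrite andbT /=; apply/hasPn => _ /mapP[I _ ->].
  by apply/mapP => -[K _]; apply: cons_neq_shift.
move=> J; rewrite mem_index_enum mem_cat; apply/esym/orP.
by case: (multiindex_cases J) => -[I ->]; [left|right]; apply: map_f;
  rewrite mem_index_enum.
Qed.

(** * Coordinate embeddings of multivectors *)

Definition push (R : realType) (n p m q : nat)
    (h : multiindex n p -> multiindex m q)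
    (xi : pvector R n p) : pvector R m q :=
  \sum_I xi I *: pbasis R (h I).

Lemma push_is_linear (R : realType) (n p m q : nat)
    (h : multiindex n p -> multiindex m q) :
  linear (@push R n p m q h).
Proof.
move=> a x y; rewrite /push scaler_sumr -big_split /=.
by apply: eq_bigr => I _; rewrite !ffunE scalerDl scalerA.
Qed.
HB.instance Definition _ (R : realType) (n p m q : nat)
    (h : multiindex n p -> multiindex m q) :=
  GRing.isLinear.Build R (pvector R n p) (pvector R m q) _ (push h)
    (push_is_linear h).

Definition pull (R : realType) (n p m q : nat)
    (h : multiindex n p -> multiindex m q)
    (phi : pcovector R m q) : pcovector R n p :=
  (phi \o linfun (push h))%VF.

Lemma push_pbasis (R : realType) (n p m q : nat)
    (h : multiindex n p -> multiindex m q) I :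
  push h (pbasis R I) = pbasis R (h I).
Proof.
rewrite /push (bigD1 I) //= big1 => [|J JI].
  by rewrite ffunE eqxx scale1r addr0.
by rewrite ffunE (negbTE JI) scale0r.
Qed.

Lemma pull_pbasis (R : realType) (n p m q : nat)
    (h : multiindex n p -> multiindex m q)
    (phi : pcovector R m q) I :
  pull h phi (pbasis R I) = phi (pbasis R (h I)).
Proof. by rewrite !lfunE /= lfunE /= push_pbasis. Qed.

Lemma push_in (R : realType) (n p m q : nat)
    (h : multiindex n p -> multiindex m q)
    (xi : pvector R n p) I :
  injective h -> push h xi (h I) = xi I.
Proof.
move=> h_inj; rewrite /push sum_ffunE (bigD1 I) //= big1 => [|J JI].
  by rewrite !ffunE eqxx addr0 /GRing.scale /= mulr1.
by rewrite !ffunE (inj_eq h_inj) eq_sym (negbTE JI) scaler0.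
Qed.

Lemma push_out (R : realType) (n p m q : nat)
    (h : multiindex n p -> multiindex m q)
    (xi : pvector R n p) J :
  (forall I, J <> h I) -> push h xi J = 0.
Proof.
move=> Jh; rewrite /push sum_ffunE big1 // => I _.
by rewrite !ffunE; case: eqP => [/Jh//|_]; rewrite scaler0.
Qed.

Lemma pnorm_push (R : realType) (n p m q : nat)
    (h : multiindex n p -> multiindex m q)
    (xi : pvector R n p) :
  injective h -> pnorm (push h xi) = pnorm xi.
Proof.
move=> h_inj; congr Num.sqrt; rewrite (bigID (mem (codom h))) /=.
rewrite [X in _ + X]big1 => [|J Jh].
  rewrite addr0 -big_uniq /=; last by rewrite map_inj_uniq ?enum_uniq.
  rewrite /codom /image_mem big_map big_enum /=.
  by apply: eq_bigr => I _; rewrite push_in.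
by rewrite push_out ?expr0n // => I JI; rewrite JI codom_f in Jh.
Qed.

(** An isometric embedding that preserves simplicity carries the competitors
    for the comass of the pulled back covector to competitors for phi. *)
Lemma comass_pull (R : realType) (n p m q : nat)
    (h : multiindex n p -> multiindex m q)
    (phi : pcovector R m q) :
  injective h ->
  (forall xi : pvector R n p, simple xi -> simple (push h xi)) ->
  comass (pull h phi) <= comass phi.
Proof.
move=> h_inj push_simple.
apply: ge_sup; first by case: (comass_has_sup (pull h phi)).
move=> _ [xi [xi_simple xi1] <-]; rewrite !lfunE /= lfunE /=.
apply: ub_le_sup; first by case: (comass_has_sup phi).
by exists (push h xi) => //; split; [apply: push_simple|rewrite pnorm_push].
Qed.

(** * Splitting off the first coordinate *)

Definition shift_vec (R : realType) (n : nat) (v : 'rV[R]_n) : 'rV[R]_n.+1 :=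
  \row_j oapp (v 0) 0 (unlift ord0 j).

(** The inclusion of R^n as the last n coordinates of R^(n+1) commutes with
    the wedge product: a minor that uses column 0 has a zero column. *)
Lemma push_shift_wedge (R : realType) (n p : nat) (v : 'I_p.+1 -> 'rV[R]_n) :
  push (@shift_index n p.+1) (wedge v) = wedge (fun i => shift_vec (v i)).
Proof.
apply/ffunP => J; have [[I ->]|[I ->]] := multiindex_cases J.
  rewrite (push_in _ _ (@shift_index_inj _ _)) !ffunE.
  by congr (\det _); apply/matrixP => i j; rewrite !mxE ffunE liftK.
rewrite push_out => [|K]; last exact: cons_neq_shift.
rewrite ffunE (expand_det_col _ ord0) big1 // => i _.
by rewrite !mxE cons_index0 unlift_none mul0r.
Qed.

(** The map xi |-> e_0 /\ xi.  The first row of each minor is that of e_0, so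
    expansion along it leaves a minor of v, or 0 if column 0 is not used. *)
Lemma push_cons_wedge (R : realType) (n p : nat) (v : 'I_p -> 'rV[R]_n) :
  push (@cons_index n p) (wedge v) =
  wedge (fun i => oapp (fun k => shift_vec (v k)) (delta_mx 0 ord0)
                       (unlift ord0 i)).
Proof.
apply/ffunP => J; have [[I ->]|[I ->]] := multiindex_cases J.
  rewrite push_out => [|K /esym]; last exact: cons_neq_shift.
  rewrite ffunE (expand_det_row _ ord0) big1 // => j _.
  by rewrite !mxE unlift_none /= mxE shift_indexE mul0r.
rewrite (push_in _ _ (@cons_index_inj _ _)) !ffunE (expand_det_row _ ord0).
rewrite big_ord_recl big1 => [|j _].
  rewrite !mxE unlift_none /= mxE cons_index0 !eqxx mul1r addr0.
  rewrite /cofactor expr0 mul1r; congr (\det _).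
  by apply/matrixP => i j; rewrite !mxE liftK /= !mxE ffunE liftK /= liftK.
by rewrite !mxE unlift_none /= mxE cons_indexS mul0r.
Qed.

Lemma dual_norm_split (R : realType) (n p : nat) (phi : pcovector R n.+1 p.+1) :
  dual_norm phi ^+ 2 = dual_norm (pull (@shift_index n p.+1) phi) ^+ 2 +
                       dual_norm (pull (@cons_index n p) phi) ^+ 2.
Proof.
rewrite /dual_norm !sqr_sqrtr; try by apply: sumr_ge0 => I _; rewrite sqr_ge0.
rewrite sum_multiindexS.
by congr (_ + _); apply: eq_bigr => I _; rewrite pull_pbasis.
Qed.

Lemma comass_pull_shift (R : realType) (n p : nat)
    (phi : pcovector R n.+1 p.+1) :
  comass (pull (@shift_index n p.+1) phi) <= comass phi.
Proof.
apply: comass_pull => [|_ [v ->]]; first exact: shift_index_inj.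
by rewrite push_shift_wedge; eexists.
Qed.

Lemma comass_pull_cons (R : realType) (n p : nat)
    (phi : pcovector R n.+1 p.+1) :
  comass (pull (@cons_index n p) phi) <= comass phi.
Proof.
apply: comass_pull => [|_ [v ->]]; first exact: cons_index_inj.
by rewrite push_cons_wedge; eexists.
Qed.

(** * Degrees in which every multivector is simple *)

(** The scalar is absorbed by the first factor of the wedge product, so there
    has to be one. *)
Lemma simpleZ (R : realType) (n p : nat) (a : R) (xi : pvector R n p) :
  (0 < p)%N -> simple xi -> simple (a *: xi).
Proof.
case: p xi => // p _ _ [v ->].
exists (fun k => if k == ord0 then a *: v k else v k).
apply/ffunP => I; rewrite !ffunE !(expand_det_row _ ord0) scaler_sumr.
apply: eq_bigr => j _; rewrite !mxE /GRing.scale /= mulrA.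
congr (_ * (_ * \det _)).
by apply/matrixP => i k; rewrite !mxE eq_sym (negbTE (neq_lift _ _)).
Qed.

Lemma simple_1vector (R : realType) (n : nat) (xi : pvector R n 1) : simple xi.
Proof.
have inc (j : 'I_n) : increasing [ffun _ : 'I_1 => j].
  by apply/increasingP => i k; rewrite !ord1.
exists (fun _ => \row_j xi (exist _ [ffun _ : 'I_1 => j] (inc j))).
apply/ffunP => I; rewrite ffunE det_mx11 !mxE; congr (xi _).
by apply/val_inj/ffunP => i; rewrite ffunE ord1.
Qed.

Lemma skip_increasing (n : nat) (j : 'I_n.+1) :
  increasing [ffun i : 'I_n => lift j i].
Proof.
by apply/increasingP => i k ik; rewrite !ffunE /= ltnNge leq_bump2 -ltnNge.
Qed.

(** In degree n, a multiindex of R^(n+1) is determined by the single index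
    that it omits. *)
Definition skip_index (n : nat) (j : 'I_n.+1) : multiindex n.+1 n :=
  exist _ [ffun i : 'I_n => lift j i] (skip_increasing j).

Lemma skip_index_surj (n : nat) (I : multiindex n.+1 n) :
  exists j, I = skip_index j.
Proof.
have [j jI] : exists j, j \notin codom (val I).
  apply/existsP; rewrite -negb_forall; apply/negP => /forallP I_full.
  have : (#|'I_n.+1| <= #|codom (val I)|)%N.
    by apply/subset_leq_card/fintype.subsetP.
  by rewrite (card_codom (@multiindex_inj _ _ I)) !card_ord ltnn.
exists j; apply: multiindex_codom => i.
have [k ->|eji] := unliftP j (val I i); last by rewrite -eji codom_f in jI.
by apply/codomP; exists k; rewrite ffunE.
Qed.

(** Up to signs the coordinates of xi form a vector c of R^(n+1), and xi is a
    multiple of the wedge product of a basis of the hyperplane orthogonal to c,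
    for nonzero c.  Such a basis is read off an
    invertible matrix U whose row 0 is proportional to c: for B the inverse of
    the transpose of U, the rows of B other than row 0 are orthogonal to c.
    Their n-minors are the cofactors of B along row 0, and these are
    proportional to row 0 of U because the adjugate of B is \det B times
    the transpose of U. *)
Lemma simple_nvector_codim1 (R : realType) (n : nat) (xi : pvector R n.+1 n) :
  (0 < n)%N -> simple xi.
Proof.
move=> n0; pose c : 'rV[R]_n.+1 := \row_j ((-1) ^+ j * xi (skip_index j)).
have cE j : xi (skip_index j) = (-1) ^+ j * c 0 j by rewrite mxE signrMK.
have [c0|c0] := eqVneq c 0.
  have -> : xi = 0 *: wedge (fun=> 0).
    apply/ffunP => I; have [j ->] := skip_index_surj I.
    by rewrite cE c0 mxE mulr0 ffunE scale0r.
  by apply: simpleZ => //; eexists.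
have [a [U Uunit cU]] : exists a : R, exists2 U : 'M[R]_n.+1,
    U \in unitmx & forall j, c 0 j = a * U 0 j.
  (* Gaussian elimination of the single nonzero row c: the matrix row_ebase c
     is invertible, and its row 0 spans the line of c. *)
  exists (col_ebase c 0 0), (row_ebase c); first exact: row_ebase_unit.
  move=> j; rewrite -{1}(mulmx_ebase c) rank_rV c0.
  rewrite [col_ebase c]mx11_scalar mul_scalar_mx -scalemxAl !mxE eqxx mulr1n.
  congr (_ * _); rewrite (bigD1 ord0) //= big1 => [|k k0].
    by rewrite !mxE eqxx mul1r addr0.
  by rewrite -val_eqE /= in k0; rewrite !mxE eq_sym (negbTE k0) mul0r.
pose B := invmx U^T; have Bunit : B \in unitmx by rewrite unitmx_inv unitmx_tr.
have detB0 : \det B != 0 by rewrite -unitfE -unitmxE.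
have -> : xi = (a / \det B) *: wedge (fun i => row (lift ord0 i) B).
  apply/ffunP => I; have [j ->] := skip_index_surj I.
  have minorE : wedge (fun i => row (lift ord0 i) B) (skip_index j) =
      (-1) ^+ j * (\det B * U 0 j).
    have -> : \det B * U 0 j = cofactor B ord0 j.
      have : \det B *: invmx B = \adj B.
        by rewrite /invmx Bunit scalerA divff ?scale1r.
      by rewrite invmxK => /matrixP/(_ j 0); rewrite !mxE.
    rewrite ffunE /cofactor add0n signrMK; congr (\det _).
    by apply/matrixP => i k; rewrite !mxE ffunE.
  rewrite ffunE minorE cE cU /GRing.scale /= [RHS]mulrCA; congr (_ * _).
  by rewrite mulrA divfK.
by apply: simpleZ => //; eexists.
Qed.

(** * Comparison of the norm and the comass *)

Lemma comass_ge0 (R : realType) (n p : nat) (phi : pcovector R n p) :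
  (0 < p)%N -> 0 <= comass phi.
Proof.
move=> p0; apply: ub_le_sup; first by case: (comass_has_sup phi).
have simple0 : simple (0 : pvector R n p).
  have -> : (0 : pvector R n p) = 0 *: wedge (fun=> 0) by rewrite scale0r.
  by apply: simpleZ => //; eexists.
exists (0 : pvector R n p); last by rewrite linear0.
split=> //; rewrite /pnorm big1 ?sqrtr0 // => I _.
by rewrite ffunE expr0n.
Qed.

(** Let xi be the p-vector with the same coordinates as phi.  Then
    phi (xi) = |phi|^2 and |xi| = |phi|, so if xi / |phi| is simple it is a
    competitor for the comass at which phi takes the value |phi|. *)
Lemma dual_norm_le_comass (R : realType) (n p : nat) (phi : pcovector R n p) :
  (0 < p)%N -> (forall xi : pvector R n p, simple xi) ->
  dual_norm phi <= comass phi.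
Proof.
move=> p0 all_simple.
have [->|d0] := eqVneq (dual_norm phi) 0; first exact: comass_ge0.
pose xi : pvector R n p := [ffun I => phi (pbasis R I)].
have dE : dual_norm phi = pnorm xi.
  by congr Num.sqrt; apply: eq_bigr => I _; rewrite ffunE.
have sqE : dual_norm phi ^+ 2 = phi xi.
  rewrite sqr_sqrtr; last by apply: sumr_ge0 => I _; rewrite sqr_ge0.
  rewrite [xi in phi xi]pvector_sum linear_sum; apply: eq_bigr => I _.
  by rewrite linearZ /= ffunE expr2.
apply: ub_le_sup; first by case: (comass_has_sup phi).
exists ((dual_norm phi)^-1 *: xi).
  split; first exact: all_simple.
  have -> : pnorm ((dual_norm phi)^-1 *: xi) = `|(dual_norm phi)^-1| * pnorm xi.
    rewrite /pnorm -sqrtr_sqr -sqrtrM ?sqr_ge0 // mulr_sumr.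
    by congr Num.sqrt; apply: eq_bigr => I _; rewrite ffunE exprMn.
  by rewrite ger0_norm ?invr_ge0 ?sqrtr_ge0 // -dE mulVf.
by rewrite linearZ /= -sqE /GRing.scale /= expr2 mulrA mulVf ?mul1r.
Qed.

(** Induction on the dimension by Pascal's rule.  With n = m + 2 and p = q + 1
    the binomial is 'C(m, q), and p <= n - 1 reads q <= m. *)
Lemma dual_norm_comass (R : realType) (m q : nat)
    (phi : pcovector R m.+2 q.+1) :
  (q <= m)%N -> dual_norm phi ^+ 2 <= 'C(m, q)%:R * comass phi ^+ 2.
Proof.
have all_simple_bound n p (psi : pcovector R n p) : (0 < p)%N ->
    (forall xi : pvector R n p, simple xi) ->
    dual_norm psi ^+ 2 <= 1%:R * comass psi ^+ 2.
  move=> p0 all_simple.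
  by rewrite mul1r lerXn2r ?nnegrE ?sqrtr_ge0 ?comass_ge0 ?dual_norm_le_comass.
elim: m q phi => [|m IHm] [|q] phi qm //.
- by rewrite bin0; apply: all_simple_bound => // xi; apply: simple_1vector.
- by rewrite bin0; apply: all_simple_bound => // xi; apply: simple_1vector.
(* Pascal's rule is applied for q < m only; at q = m the degree is n - 1. *)
move: qm; rewrite ltnS leq_eqVlt => /predU1P[qm|qm].
  rewrite qm in phi *.
  by rewrite binn; apply: all_simple_bound => // xi;
    apply: simple_nvector_codim1.
rewrite binS natrD mulrDl dual_norm_split.
apply: lerD.
  apply: le_trans (IHm _ _ qm) _; apply: ler_wpM2l => //.
  by rewrite lerXn2r ?nnegrE ?comass_ge0 ?comass_pull_shift.
apply: le_trans (IHm _ _ (ltnW qm)) _; apply: ler_wpM2l => //.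
by rewrite lerXn2r ?nnegrE ?comass_ge0 ?comass_pull_cons.
Qed.

(** The supremum is over a nonempty set, so it is not -oo, whose square would
    be +oo: a coordinate function is a nonzero covector, as p <= n provides a
    multiindex. *)
Lemma comass_constant_ge0 (R : realType) (n p : nat) :
  (0 < p <= n)%N -> (0 <= comass_constant R n p)%E.
Proof.
move=> /andP[p0 pn].
have inc : increasing [ffun i : 'I_p => widen_ord pn i].
  by apply/increasingP => i j; rewrite !ffunE.
pose I : multiindex n p := exist _ [ffun i : 'I_p => widen_ord pn i] inc.
have coord_linear : linear (fun xi : pvector R n p => xi I).
  by move=> a x y; rewrite !ffunE.
pose coord := GRing.isLinear.Build R (pvector R n p) R^o _ _ coord_linear.
pose coordL : {linear pvector R n p -> R^o} :=
  HB.pack (fun xi : pvector R n p => xi I) coord.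
pose phi : pcovector R n p := linfun coordL.
have phi0 : phi != 0.
  apply/eqP => /lfunP/(_ (pbasis R I)).
  by rewrite !lfunE /= ffunE eqxx => /eqP; rewrite oner_eq0.
apply: (@le_trans _ _ (dual_norm phi / comass phi)%:E).
  by rewrite lee_fin divr_ge0 ?sqrtr_ge0 ?comass_ge0.
by apply: ereal_sup_ubound; exists phi.
Qed.

Theorem corollary2p4 (R : realType) (n p : nat)
    (hp : (1 <= p)%N) (hpn : (p <= n - 1)%N) :
  (comass_constant R n p ^+ 2 <= ('C(n - 2, p - 1)%:R)%:E)%E.
Proof.
case: p hp hpn => // q _; case: n => // -[//|m]; rewrite !subSS !subn0 => qm.
have C0 : (0 <= comass_constant R m.+2 q.+1)%E.
  by apply: comass_constant_ge0; rewrite /= ltnS ltnW.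
have b0 : 0 <= 'C(m, q)%:R :> R by [].
rewrite -(sqr_sqrtr b0) EFin_expe.
have : (comass_constant R m.+2 q.+1 <= (Num.sqrt 'C(m, q)%:R)%:E)%E.
  apply: ge_ereal_sup => _ [phi /= phi0 <-].
  rewrite lee_fin ler_pdivrMr ?comass_gt0 //.
  rewrite -(@ler_pXn2r _ 2) ?nnegrE ?mulr_ge0 ?sqrtr_ge0 ?comass_ge0 //.
  by rewrite exprMn (sqr_sqrtr b0) dual_norm_comass.
by move=> le; rewrite !expe2 lee_pmul.
Qed.
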